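(* Let $m\ge 2$. There is a constant $c>0$ such that for every positive integer $n$, with probability at least $1-e^{-c(\log n)^{1/4}}$ the graph $G_m^n$ contains as a subgraph a one-subdivided clique of size $\lfloor(\log n)^{1/4}\rfloor$.
   Context: Preferential attachment process. For $m=1$: $G_1^1$ is a single vertex $v_1$ with one self-loop. For $t\ge2$, $G_1^t$ is obtained from $G_1^{t-1}$ (vertex set $\{v_1,\dots,v_{t-1}\}$) by adding a new vertex $v_t$ together with one edge from $v_t$ to $v_s$, where $s\in\{1,\dots,t\}$ is chosen at random (given the past) with probability $d_1^{t-1}(v_s)/(2t-1)$ for $s<t$ and $1/(2t-1)$ for $s=t$ (a self-loop at $v_t$); $d_1^t(v)$ is the degree of $v$ in $G_1^t$, a self-loop contributing $2$. For $m\ge1$, $G_m^n$ is obtained from $G_1^{mn}$ (vertices $v'_1,\dots,v'_{mn}$) by merging, for each $i\le n$, the vertices $v'_{(i-1)m+1},\dots,v'_{im}$ into one vertex $v_i$, keeping all edges (a multigraph with loops). A one-subdivided clique of size $k$ is the graph obtained from the complete graph $K_k$ by replacing every edge by a path of length $2$ (with pairwise distinct new middle vertices); ''contains as a subgraph'' means there are $k$ distinct vertices and, for each pair of them, a distinct further vertex adjacent to both. *)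

(* Defs.v *)
From HB Require Import structures.
From mathcomp Require Import all_boot all_order all_algebra.
From mathcomp Require Import all_classical all_reals all_analysis.

Set Implicit Arguments.
Unset Strict Implicit.
Unset Printing Implicit Defensive.

Import Order.TTheory GRing.Theory Num.Theory.

Local Open Scope ring_scope.

(* A multigraph with loops on the vertex type V, given by the list of its
   edges.  The order of the two endpoints of an edge is irrelevant below. *)
Definition multigraph (V : Type) := seq (V * V).

Definition degree (V : eqType) (G : multigraph V) (v : V) : nat :=
  (\sum_(e <- G) ((e.1 == v) + (e.2 == v)))%N.

Definition adjacent (V : eqType) (G : multigraph V) (u v : V) : bool :=
  ((u, v) \in G) || ((v, u) \in G).

Definition merge (V W : Type) (f : V -> W) (G : multigraph V) : multigraph W :=
  [seq (f e.1, f e.2) | e <- G].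

(* b lists the branch vertices; w i j, used for i < j only, is the vertex
   subdividing the edge {i, j} of the complete graph on 'I_k. *)
Definition contains_subdivided_clique (V : eqType) (G : multigraph V)
    (k : nat) : Prop :=
  exists (b : 'I_k -> V) (w : 'I_k -> 'I_k -> V),
    [/\ injective b,
        forall i j l : 'I_k, (i < j)%N -> w i j <> b l,
        forall i j i' j' : 'I_k, (i < j)%N -> (i' < j')%N ->
          w i j = w i' j' -> i = i' /\ j = j'
      & forall i j : 'I_k, (i < j)%N ->
          adjacent G (b i) (w i j) /\ adjacent G (w i j) (b j)].

(* Vertices are numbered from 0.  The first N steps of the process are recorded
   by the function s sending each vertex t : 'I_N to the other endpoint s t of
   the edge added together with t.  After the first t vertices 0, ..., t.-1 have
   been added, the graph is PA1 s t; vertices of 'I_N that are at least t are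
   not yet born. *)
Definition PA1 (N : nat) (s : 'I_N -> 'I_N) (t : nat) : multigraph 'I_N :=
  [seq (j, s j) | j : 'I_N <- enum 'I_N & (j < t)%N].

(* Conditional probability, given the past, that the new vertex t attaches to i.
   With t earlier vertices the denominator 2(t+1)-1 is 2t+1. *)
Definition attach_prob (R : realType) (N : nat) (s : 'I_N -> 'I_N)
    (t i : 'I_N) : R :=
  if (i < t)%N then (degree (PA1 s t) i)%:R / (2 * t + 1)%:R
  else if i == t then 1 / (2 * t + 1)%:R
  else 0.

Definition pa_mass (R : realType) (N : nat) (s : {ffun 'I_N -> 'I_N}) : R :=
  \prod_(t < N) attach_prob R s t (s t).

Definition pa_prob (R : realType) (N : nat)
    (A : {ffun 'I_N -> 'I_N} -> Prop) : R :=
  \sum_(s : {ffun 'I_N -> 'I_N} | `[< A s >]) pa_mass R s.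

Lemma block_subproof (m n : nat) (t : 'I_(m * n)) : (t %/ m < n)%N.
Proof.
have m0 : (0 < m)%N by case: m t => // -[t]; rewrite mul0n.
by rewrite ltn_divLR // (mulnC n) ltn_ord.
Qed.

Definition block (m n : nat) (t : 'I_(m * n)) : 'I_n :=
  Ordinal (block_subproof t).

Definition PA (m n : nat) (s : {ffun 'I_(m * n) -> 'I_(m * n)}) :
    multigraph 'I_n :=
  merge (@block m n) (PA1 s (m * n)).

Lemma attach_prob_ge0 (R : realType) (N : nat) (s : 'I_N -> 'I_N)
  (t i : 'I_N) : 0 <= attach_prob R s t i.
Proof. by rewrite /attach_prob; do 2 case: ifP => // _; exact: divr_ge0. Qed.

Lemma pa_mass_ge0 (R : realType) (N : nat) (s : {ffun 'I_N -> 'I_N}) :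
  0 <= pa_mass R s.
Proof. by apply: prodr_ge0 => t _; exact: attach_prob_ge0. Qed.

Lemma attach_prob_sum1 (R : realType) (N : nat) (s : 'I_N -> 'I_N)
    (t : 'I_N) :
  (forall j : 'I_N, (j < t)%N -> (s j <= j)%N) ->
  \sum_(i < N) attach_prob R s t i = 1.
Proof.
move=> sle.
have degE : (\sum_(i < N | (i < t)%N) degree (PA1 s t) i = 2 * t)%N.
  rewrite /degree exchange_big /= big_map big_filter /= big_enum_cond /=.
  rewrite (eq_bigr (fun=> 2)) => [|j jt].
    rewrite sum_nat_const mulnC; congr (_ * _)%N.
    rewrite -sum1_card -(big_ord_widen _ (fun=> 1%N) (ltnW (ltn_ord t))).
    by rewrite sum1_card card_ord.
  rewrite big_split /= (bigD1 j) //= eqxx big1; last first.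
    by move=> i /andP[_ /negbTE]; rewrite eq_sym => ->.
  rewrite (bigD1 (s j)) /=; last exact: leq_ltn_trans (sle _ jt) jt.
  rewrite eqxx big1 // => i /andP[_ /negbTE].
  by rewrite eq_sym => ->.
rewrite (bigID (fun i : 'I_N => (i < t)%N)) /=.
under eq_bigr => i it do rewrite /attach_prob it.
rewrite -mulr_suml -natr_sum degE (bigD1 t) ?ltnn //= big1.
  rewrite /attach_prob ltnn eqxx addr0 -mulrDl natr1 addn1.
  by rewrite divff // pnatr_eq0.
by move=> i /andP[/negbTE it /negbTE i_t]; rewrite /attach_prob it i_t.
Qed.

Definition update (N : nat) (k : 'I_N) (s : {ffun 'I_N -> 'I_N}) (i : 'I_N) :
  {ffun 'I_N -> 'I_N} := [ffun j => if j == k then i else s j].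

Lemma sum_update (R : realType) (N : nat) (k : 'I_N)
    (H : {ffun 'I_N -> 'I_N} -> R) :
  \sum_s \sum_i H (update k s i) = N%:R * \sum_s H s.
Proof.
rewrite pair_bigA /=.
pose h (p : {ffun 'I_N -> 'I_N} * 'I_N) := (update k p.1 p.2, p.1 k).
have hK : involutive h.
  move=> [s i]; rewrite /h /=; congr (_, _); last by rewrite ffunE eqxx.
  by apply/ffunP => j; rewrite !ffunE; case: eqP => // ->.
rewrite (reindex_inj (inv_inj hK)) /=.
rewrite (eq_bigr (fun p : {ffun 'I_N -> 'I_N} * 'I_N => H p.1)); last first.
  by move=> p _; congr H; have := hK p; case: p => s i [].
rewrite -(pair_bigA _ (fun s _ => H s)) /= mulr_sumr.
by apply: eq_bigr => s _; rewrite sumr_const card_ord mulr_natl.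
Qed.

Lemma PA1_update (N : nat) (k : 'I_N) (s : {ffun 'I_N -> 'I_N}) (i : 'I_N)
  (t : nat) : (t <= k)%N -> PA1 (update k s i) t = PA1 s t.
Proof.
move=> tk; apply/eq_in_map => j; rewrite mem_filter => /andP[jt _].
by rewrite ffunE -val_eqE ltn_eqF // (leq_trans jt tk).
Qed.

Lemma pa_mass_sum1 (R : realType) (N : nat) :
  \sum_(s : {ffun 'I_N -> 'I_N}) pa_mass R s = 1.
Proof.
pose F k (s : {ffun 'I_N -> 'I_N}) : R :=
  \prod_(t < N | (t < k)%N) attach_prob R s t (s t).
have step k : (k <= N)%N ->
    (N ^ k)%:R * \sum_s F k s = (N ^ N)%:R :> R.
  elim: k => [|k IH] kN.
    rewrite mul1r (eq_bigr (fun=> 1)) => [|s _]; last by rewrite /F big_pred0.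
    by rewrite sumr_const card_ffun card_ord.
  rewrite -(IH (ltnW kN)) expnS mulnC natrM -mulrA; congr (_ * _).
  pose K := Ordinal kN.
  rewrite -(sum_update K); apply: eq_bigr => s _.
  have FS i : F k.+1 (update K s i) = attach_prob R s K i * F k s.
    rewrite /F (bigD1 K) //=; congr (_ * _).
      by rewrite /attach_prob PA1_update // ffunE eqxx.
    apply: eq_big => [t|t /andP[tk tK]].
      by rewrite -val_eqE /= ltnS ltn_neqAle andbC.
    by rewrite /attach_prob PA1_update // ffunE (negbTE tK).
  under eq_bigr do rewrite FS.
  rewrite -mulr_suml.
  have [[j /andP[jk sj]]|nex] :=
    pselect (exists j : 'I_N, (j < k)%N && (j < s j)%N).
    have p0 : attach_prob R s j (s j) = 0.
      by rewrite /attach_prob ltnNge (ltnW sj) -val_eqE /= gtn_eqF.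
    by rewrite {1 2}/F [\prod_(t < N | _) _](bigD1 j) //= p0 !mul0r mulr0.
  rewrite attach_prob_sum1 ?mul1r // => j jk; rewrite leqNgt.
  by apply/negP => sj; apply: nex; exists j; rewrite jk.
have := step N (leqnn N).
have NN : (N ^ N)%:R != 0 :> R.
  by rewrite pnatr_eq0 -lt0n; case: (N) => // n; rewrite expn_gt0.
rewrite -[RHS]mulr1 => /(mulfI NN) <-.
by apply: eq_bigr => s _; apply: eq_bigl => t; rewrite ltn_ord.
Qed.

(* Main.v *)
(* Put k = floor((log n)^(1/4)).  The branch vertices are chosen among the first
   8k blocks.  If a block has degree d, step t multiplies 1 / (d - 1) by
   1 - 1 / (2t + 1) on average, and for a set S of blocks the product of these
   quantities by exactly 1 - #|S| / (2t + 1).  Hence, when block b is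
   about to be added, all the blocks of S have degree below e sqrt(b / 8k) with
   probability at most e^#|S|.  A union bound over S and Markov's inequality for
   a time average show that, with probability 1 - O(4^-k), fewer than k blocks
   have such a low degree at all but a small (weighted) fraction of the times,
   so that at least k blocks are good most of the time.  A new block b sends its
   first edge to i and its second one to j with probability at least
   e^2 / (200 m^2 k b) when i and j are both good.  These rates sum to order
   (log n) / k >= k^3, so a pair that is often good has no such common neighbour
   with probability exp(- Omega(k^3)).  Recording the ordered pair (i, j) in the
   first two edges of b makes the middle vertices of different pairs distinct.
   The finitely many remaining n are absorbed in the constant c, because the
   event always has positive probability. *)
Require Import Defs.
From HB Require Import structures.
From mathcomp Require Import all_boot all_order all_algebra.
From mathcomp Require Import all_classical all_reals all_analysis.
From mathcomp Require Import ring lra zify.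
Import Order.TTheory GRing.Theory Num.Theory.
Local Open Scope ring_scope.

Set Implicit Arguments.
Unset Strict Implicit.
Unset Printing Implicit Defensive.

(** * Means over the first steps of the process, supermartingales and elementary probability
    bounds *)

Section Process.
Variables (R : realType) (N : nat).
Notation config := {ffun 'I_N -> 'I_N}.
Implicit Types (s : config) (F G : config -> R).

Definition pa_valid (t : nat) s := forall j : 'I_N, (j < t)%N -> (s j <= j)%N.

Definition pa_step (t : 'I_N) F s : R :=
  \sum_i attach_prob R s t i * F (update t s i).

(* Mean of F over the first k steps.  The sum also runs over the N - k other
   coordinates of s; the factor in front averages over them uniformly. *)
Definition pa_mean (k : nat) F : R :=
  (N ^ k)%:R / (N ^ N)%:R *
  \sum_(s : config) (\prod_(t < N | (t < k)%N) attach_prob R s t (s t)) * F s.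

(** Conditioning on the past of step t. By [sum_update], coordinate t of s becomes a separate
    summation index at the cost of the factor N by which the two normalisations differ. *)
Lemma pa_mean_step (t : 'I_N) F : pa_mean t.+1 F = pa_mean t (pa_step t F).
Proof.
rewrite /pa_mean expnSr natrM [_ * N%:R / _]mulrAC -[LHS]mulrA.
have := sum_update t (fun s => (\prod_(j < N | (j < t.+1)%N)
  attach_prob R s j (s j)) * F s).
move=> <-; congr (_ * _).
apply: eq_bigr => s _; rewrite /pa_step mulr_sumr; apply: eq_bigr => i _.
rewrite mulrA; congr (_ * _); rewrite (bigD1 t) //= mulrC; congr (_ * _).
  apply: eq_big => [j|j /andP[jt j_t]].
    by rewrite -val_eqE /= ltnS [RHS]ltn_neqAle andbC.
  by rewrite /attach_prob PA1_update // ffunE (negbTE j_t).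
by rewrite /attach_prob PA1_update // ffunE eqxx.
Qed.

Lemma pa_mean_full F : pa_mean N F = \sum_(s : config) pa_mass R s * F s.
Proof.
rewrite /pa_mean divff ?mul1r; last first.
  by rewrite pnatr_eq0 -lt0n; case: (N) => // n; rewrite expn_gt0.
apply: eq_bigr => s _; congr (_ * _).
by apply: eq_bigl => t; rewrite ltn_ord.
Qed.

(** A configuration outside [pa_valid k] has some j < k with s j > j, where [attach_prob] is 0, so
    it carries no weight in either mean. *)
Lemma ler_pa_mean k F G : (forall s, pa_valid k s -> F s <= G s) ->
  pa_mean k F <= pa_mean k G.
Proof.
move=> FG; rewrite /pa_mean; apply: ler_wpM2l; first exact: divr_ge0.
apply: ler_sum => s _.
have [vs|nvs] := pselect (pa_valid k s).
  apply: ler_wpM2l (FG _ vs).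
  by apply: prodr_ge0 => t _; exact: attach_prob_ge0.
have [j] : exists j : 'I_N, (j < k)%N && (j < s j)%N.
  apply: contra_notP nvs => nex j jk; rewrite leqNgt; apply/negP => sj.
  by apply: nex; exists j; rewrite jk.
move=> /andP[jk sj]; rewrite (bigD1 j) //=.
suff -> : attach_prob R s j (s j) = 0 by rewrite !mul0r.
by rewrite /attach_prob ltnNge (ltnW sj) -val_eqE /= gtn_eqF.
Qed.

Lemma pa_step_const (t : 'I_N) F s : pa_valid t s ->
  (forall i, F (update t s i) = F s) -> pa_step t F s = F s.
Proof.
move=> vs Fs; rewrite /pa_step.
under eq_bigr do rewrite Fs.
by rewrite -mulr_suml attach_prob_sum1 ?mul1r.
Qed.

(** By [pa_mean_step] the mean of V t over the first t steps cannot increase after t0, and at t0 it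
    is at most the mean of the constant c. *)
Lemma pa_supermartingale (V : nat -> config -> R) (t0 : nat) (c : R) :
  (t0 <= N)%N -> (forall s, pa_valid t0 s -> V t0 s <= c) ->
  (forall (t : 'I_N) s, (t0 <= t)%N -> pa_valid t s ->
     pa_step t (V t.+1) s <= V t s) ->
  \sum_(s : config) pa_mass R s * V N s <= c.
Proof.
move=> t0N V0 VS; rewrite -pa_mean_full.
(* Downward induction from k = N, where the total mass is 1. *)
have mean1 k : (k <= N)%N -> pa_mean k (fun=> c) = c.
  move=> kN; have [d] := ubnP (N - k)%N; elim: d k kN => // d IH k kN dk.
  have [->|kltN] := eqVneq k N.
    by rewrite pa_mean_full -mulr_suml pa_mass_sum1 mul1r.
  have ltkN : (k < N)%N by rewrite ltn_neqAle kltN.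
  rewrite -[RHS](IH k.+1 ltkN); last by lia.
  rewrite (pa_mean_step (Ordinal ltkN)); apply/eqP; rewrite eq_le.
  by apply/andP; split; apply: ler_pa_mean => s vs;
    rewrite (pa_step_const (F := fun=> c)).
have mono d : (t0 + d <= N)%N -> pa_mean (t0 + d) (V (t0 + d)%N) <= c.
  elim: d => [|d IH] dN.
    rewrite addn0 -[leRHS](mean1 t0 t0N); apply: ler_pa_mean => s. exact: V0.
  rewrite addnS in dN *; apply: le_trans (IH (ltnW dN)).
  rewrite (pa_mean_step (Ordinal dN)); apply: ler_pa_mean => s vs.
  by apply: VS => //=; exact: leq_addr.
by have := mono (N - t0)%N; rewrite subnKC // => /(_ (leqnn N)).
Qed.

Lemma pa_prob_markov (A : config -> Prop) F :
  (forall s, 0 <= F s) -> (forall s, A s -> 1 <= F s) ->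
  pa_prob R A <= \sum_(s : config) pa_mass R s * F s.
Proof.
move=> F0 F1; rewrite /pa_prob big_mkcond; apply: ler_sum => s _.
case: asboolP => As; last by rewrite mulr_ge0 // pa_mass_ge0.
by rewrite ler_peMr ?pa_mass_ge0 // F1.
Qed.

Lemma pa_probC (A : config -> Prop) :
  pa_prob R A = 1 - pa_prob R (fun s => ~ A s).
Proof.
rewrite -(pa_mass_sum1 R N) [X in _ = X - _](bigID (fun s => `[< A s >])) /=.
rewrite /pa_prob.
rewrite [X in _ - X](eq_bigl (fun s => ~~ `[< A s >])) ?addrK // => s.
by rewrite asbool_neg.
Qed.

Lemma le_pa_prob (A B : config -> Prop) : (forall s, A s -> B s) ->
  pa_prob R A <= pa_prob R B.
Proof.
move=> AB; rewrite /pa_prob [leLHS]big_mkcond [leRHS]big_mkcond.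
apply: ler_sum => s _; case: asboolP => As.
  by case: asboolP => // nB; case: nB; exact: AB.
by case: ifP => // _; exact: pa_mass_ge0.
Qed.

Lemma pa_prob_union (I : finType) (P : pred I) (A : I -> config -> Prop) :
  pa_prob R (fun s => exists2 i, P i & A i s) <=
  \sum_(i | P i) pa_prob R (A i).
Proof.
rewrite /pa_prob [leRHS](exchange_big_dep xpredT) //= big_mkcond /=.
apply: ler_sum => s _; case: asboolP => [[i Pi Ai]|_]; last first.
  by apply: sumr_ge0 => i _; exact: pa_mass_ge0.
rewrite (bigD1 i) /=; last by rewrite Pi; apply/asboolP.
by rewrite lerDl; apply: sumr_ge0 => j _; exact: pa_mass_ge0.
Qed.

Lemma pa_prob_or (A B : config -> Prop) :
  pa_prob R (fun s => A s \/ B s) <= pa_prob R A + pa_prob R B.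
Proof.
rewrite /pa_prob [leLHS]big_mkcond !(big_mkcond (fun s => `[< _ s >])).
rewrite -big_split /=; apply: ler_sum => s _; have m0 := pa_mass_ge0 R s.
by do 3 (case: asboolP => ?); first [lra | exfalso; tauto].
Qed.

End Process.

(** * Degrees of merged blocks *)

Lemma sum_pred_eq (T : finType) (P : pred T) (x : T) :
  (\sum_(y | P y) (x == y) = P x)%N.
Proof.
rewrite big_mkcond (bigD1 x) //= eqxx big1 ?addn0 => [|y /negbTE yx].
  by case: (P x).
by rewrite eq_sym yx; case: ifP.
Qed.

Section BlockDegree.
Variables (R : realType) (N m : nat).
Notation config := {ffun 'I_N -> 'I_N}.
Implicit Types (s : config).

(* The block reached by the edge of vertex t, with junk value 0 if t >= N. *)
Definition target s (t : nat) : nat :=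
  if insub t is Some x then (s x %/ m)%N else 0%N.

(** For t at most N, the degree of block i after t steps, with loops counted twice. *)
Definition bdeg s (t i : nat) : nat :=
  (\sum_(0 <= u < t) ((u %/ m == i) + (target s u == i)))%N.

Lemma target_ord s (t : 'I_N) : target s t = (s t %/ m)%N.
Proof. by rewrite /target valK. Qed.

Lemma target_update s (t v : 'I_N) (u : nat) :
  target (update t s v) u = if u == t then (v %/ m)%N else target s u.
Proof.
rewrite /target; case: insubP => [x _ <-|].
  by rewrite ffunE val_eqE; case: ifP.
by case: eqVneq => // ->; rewrite ltn_ord.
Qed.

Lemma bdeg_update s (k v : 'I_N) t i : (t <= k)%N ->
  bdeg (update k s v) t i = bdeg s t i.
Proof.
move=> tk; apply: eq_big_nat => u /andP[_ ut].
by rewrite target_update (ltn_eqF (leq_trans ut tk)).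
Qed.

Lemma bdegS s t i :
  bdeg s t.+1 i = (bdeg s t i + ((t %/ m == i) + (target s t == i)))%N.
Proof. by rewrite /bdeg big_nat_recr. Qed.

Lemma bdegS_update s (t v : 'I_N) i :
  bdeg (update t s v) t.+1 i =
  (bdeg s t i + ((t %/ m == i) + (v %/ m == i)))%N.
Proof. by rewrite bdegS bdeg_update // target_update eqxx. Qed.

Lemma leq_bdeg s t t' i : (t <= t')%N -> (bdeg s t i <= bdeg s t' i)%N.
Proof.
by move=> tt'; rewrite /bdeg [leqRHS](@big_cat_nat _ _ _ t) //= leq_addr.
Qed.

(** Already the first two vertices of the block give two edge ends. This keeps degree minus 1 away
    from 0 in the negative moments. *)
Lemma bdeg_ge2 s t i : (2 <= m)%N -> (i.+1 * m <= t)%N -> (2 <= bdeg s t i)%N.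
Proof.
move=> m2 it; apply: leq_trans (leq_bdeg s i it).
have m0 : (0 < m)%N by exact: ltnW.
have : (bdeg s (i * m).+2 i <= bdeg s (i.+1 * m) i)%N by apply: leq_bdeg; lia.
have im1 : ((i * m).+1 %/ m = i)%N.
  by rewrite -addn1 divnMDl // divn_small // addn0.
by apply: leq_trans; rewrite !bdegS im1 mulnK // eqxx; lia.
Qed.

(** The block is complete at time t, so all its vertices are older than t, the self-loop case does
    not arise, and the vertex degrees add up to [bdeg]. *)
Lemma sum_attach_block s (t : 'I_N) i : (0 < m)%N -> (i.+1 * m <= t)%N ->
  \sum_v attach_prob R s t v * (v %/ m == i)%N%:R =
  (bdeg s t i)%:R / (2 * t + 1)%:R.
Proof.
move=> m0 it.
transitivity (\sum_(v < N | (v %/ m == i)%N)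
    (degree (PA1 s t) v)%:R / (2 * t + 1)%:R : R).
  rewrite [RHS]big_mkcond; apply: eq_bigr => v _.
  case: ifPn => [/eqP vi|_]; last by rewrite mulr0.
  rewrite mulr1 /attach_prob; case: ltnP => // tv; exfalso.
  by have := leq_trans it tv; rewrite -leq_divRL // vi ltnn.
rewrite -mulr_suml -natr_sum; congr (_%:R / _).
rewrite /degree exchange_big /= big_map big_filter /= big_enum_cond /=.
rewrite /bdeg big_mkord (big_ord_widen N
  (fun u => (u %/ m == i) + (target s u == i))%N (ltnW (ltn_ord t))).
apply: eq_bigr => j jt; rewrite target_ord big_split /=.
by congr addn; exact: sum_pred_eq.
Qed.

End BlockDegree.

(** * Negative moments of block degrees and the probability of low degrees *)

Section NegativeMoment.
Variable R : realType.

Lemma bernoulli_ge (y : R) (n : nat) : 0 <= y <= 1 ->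
  1 - n%:R * y <= (1 - y) ^+ n.
Proof.
move=> y01; elim: n => [|n IH]; first by rewrite mul0r subr0.
have y1 : 0 <= 1 - y by lra.
have := ler_wpM2l y1 IH; rewrite exprS; apply: le_trans.
rewrite -natr1; have : 0 <= n%:R * (y * y) by rewrite !mulr_ge0 //; lra.
by lra.
Qed.

(** After squaring this is (t + 1)(2t)^2 <= t (2t + 1)^2. It makes the normalisation by sqrt t
    absorb the factor 1 - 1 / (2t + 1). *)
Lemma sqrt_succ_le (t : nat) :
  Num.sqrt t.+1%:R * (1 - (2 * t + 1)%:R^-1) <= Num.sqrt t%:R :> R.
Proof.
set d : R := (2 * t + 1)%:R.
have d1 : 1 <= d by rewrite ler1n; lia.
have y1 : 0 <= 1 - d^-1 by rewrite subr_ge0 invf_le1 //; lra.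
rewrite -[X in _ * X <= _](ger0_norm y1) -sqrtr_sqr -sqrtrM // ler_sqrt //.
have dE : d = 2 * t%:R + 1 by rewrite /d natrD natrM.
have t0 : 0 <= t%:R :> R by [].
rewrite -natr1; clearbody d; move: dE t0; move: (t%:R : R) => x dE x0.
have -> : (x + 1) * (1 - d^-1) ^+ 2 = (x + 1) * (2 * x) ^+ 2 / d ^+ 2.
  have -> : 1 - d^-1 = 2 * x / d by rewrite dE; field; lra.
  by rewrite expr_div_n mulrA.
rewrite ler_pdivrMr ?exprn_gt0 //; last by lra.
by rewrite dE; nra.
Qed.

(** At most one factor differs from 1, and it is x / (x + 1) = 1 - 1 / (x + 1). The product over
    blocks thus becomes linear in the hitting events, and its mean can be taken termwise. *)
Lemma prod_shift1 (T : finType) (S : {set T}) (x : T -> R) (e : pred T) :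
  (forall i, i \in S -> 0 < x i) ->
  (forall i j, e i -> e j -> i = j) ->
  \prod_(i in S) (x i / (x i + (e i)%:R)) =
  1 - \sum_(i in S) (e i)%:R / (x i + 1).
Proof.
move=> x0 e1; have [/existsP[i /andP[iS ei]]|] := boolP [exists i in S, e i].
  have eF j : (j \in S) && (j != i) -> e j = false.
    by move=> /andP[_ ji]; apply: contra_neqF ji => ej; exact: e1.
  rewrite (bigD1 i) //= [in RHS](bigD1 i) //= ei big1 => [|j /[dup] jS /eF ->].
    rewrite big1 => [|j /eF ->]; last by rewrite mul0r.
    by have := x0 i iS; move: (x i) => y y0 /=; rewrite ?mulr1n; field; lra.
  rewrite addr0 divff // gt_eqF // x0 //; by case/andP: jS.
rewrite negb_exists_in => /forall_inP eF.
rewrite big1 => [|i iS]; last first.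
  by rewrite (negbTE (eF i iS)) addr0 divff // gt_eqF // x0.
by rewrite big1 ?subr0 // => i iS; rewrite (negbTE (eF i iS)) mul0r.
Qed.

Variables (N m K : nat).
Hypothesis m2 : (2 <= m)%N.
Notation config := {ffun 'I_N -> 'I_N}.
Implicit Types (s : config) (S : {set 'I_K}).

(** With d - 1 in place of d, a hit lowers the reciprocal by the proportion 1 / d, which cancels the
    degree in the hitting probability d / (2t + 1). *)
Definition neg_moment S (t : nat) s : R :=
  \prod_(i in S) (Num.sqrt t%:R / ((bdeg m s t i)%:R - 1)).

Lemma bdeg_subr1_ge1 s t (i : 'I_K) : (m * K <= t)%N ->
  1 <= (bdeg m s t i)%:R - 1 :> R.
Proof.
move=> Kt; have : (2 <= bdeg m s t i)%N.
  by apply: bdeg_ge2 => //; have := ltn_ord i; nia.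
by rewrite -(ler_nat R); lra.
Qed.

Lemma neg_moment_ge0 S t s : (m * K <= t)%N -> 0 <= neg_moment S t s.
Proof.
move=> Kt; apply: prodr_ge0 => i _; apply: divr_ge0; first exact: sqrtr_ge0.
by have := bdeg_subr1_ge1 s i Kt; lra.
Qed.

(* A block of degree d is hit with probability d / (2t + 1), and then
   1 / (d - 1) is multiplied by 1 - 1 / d; as no two blocks are hit at the same
   time, the product over S decreases on average by exactly the factor
   1 - #|S| / (2t + 1). *)
Lemma neg_moment_step S s (t : 'I_N) : (m * K <= t)%N -> pa_valid t s ->
  pa_step t (neg_moment S t.+1) s <= neg_moment S t s.
Proof.
move=> Kt vs; have m0 : (0 < m)%N by exact: ltnW.
pose x (i : 'I_K) : R := (bdeg m s t i)%:R - 1.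
have x1 i : 1 <= x i by exact: bdeg_subr1_ge1.
have x0 i : 0 < x i by have := x1 i; lra.
pose c : R := \prod_(i in S) (x i)^-1.
have c0 : 0 <= c by apply: prodr_ge0 => i _; rewrite invr_ge0 ltW.
pose y : R := (2 * t + 1)%:R^-1.
have y01 : 0 <= y <= 1.
  by rewrite invr_ge0 ler0n invf_le1 ?ler1n ?ltr0n //; lia.
have updE v : neg_moment S t.+1 (update t s v) =
    Num.sqrt t.+1%:R ^+ #|S| * c *
    (1 - \sum_(i in S) (v %/ m == i)%N%:R / (x i + 1)).
  have <- := @prod_shift1 _ S x (fun i => v %/ m == i)%N; last 2 first.
  - by [].
  - by move=> i j /eqP vi /eqP vj; apply: val_inj; rewrite /= -vi -vj.
  rewrite -prodr_const -!big_split /=; apply: eq_bigr => i _.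
  (* As t >= m * K, vertex t lies in no block of S, so only its target can raise a degree. *)
  rewrite bdegS_update [(t %/ m == i)%N]gtn_eqF ?add0n; last first.
    by apply: leq_trans (ltn_ord i) _; rewrite leq_divRL // mulnC.
  rewrite natrD addrAC -/(x i) -mulrA [_^-1 * _]mulrA.
  by rewrite (mulVf (lt0r_neq0 (x0 i))) mul1r.
rewrite /pa_step; under eq_bigr do rewrite updE mulrCA.
rewrite -mulr_sumr.
have -> : \sum_(v < N) attach_prob R s t v *
    (1 - \sum_(i in S) (v %/ m == i)%N%:R / (x i + 1)) = 1 - #|S|%:R * y.
  under eq_bigr do rewrite mulrBr mulr1 mulr_sumr.
  rewrite sumrB attach_prob_sum1 // exchange_big /=; congr (1 - _).
  rewrite mulr_natl -sumr_const; apply: eq_bigr => i _.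
  under eq_bigr do rewrite mulrA.
  rewrite -mulr_suml sum_attach_block //; last by have := ltn_ord i; nia.
  rewrite /x subrK -mulrA mulrC -mulrA mulVf ?mulr1 //.
  by have := x1 i; rewrite /x => ?; apply/eqP => d0; lra.
have -> : neg_moment S t s = Num.sqrt t%:R ^+ #|S| * c.
  by rewrite -prodr_const -big_split.
rewrite mulrAC; apply: ler_wpM2r => //.
apply: le_trans (ler_wpM2l _ (bernoulli_ge #|S| y01)) _.
  by rewrite exprn_ge0 ?sqrtr_ge0.
rewrite -exprMn lerXn2r ?nnegrE ?sqrtr_ge0 ?sqrt_succ_le //.
by rewrite mulr_ge0 ?sqrtr_ge0 //; lra.
Qed.

Lemma mean_neg_moment S (T : nat) : (m * K <= T <= N)%N ->
  \sum_(s : config) pa_mass R s * neg_moment S T s <=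
  Num.sqrt (m * K)%:R ^+ #|S|.
Proof.
move=> /andP[KT TN].
(* The process is frozen at time T, because [pa_supermartingale] bounds the value at time N. *)
pose U (t : nat) s := neg_moment S (minn t T) s.
rewrite -[T in neg_moment S T](minn_idPr TN) -/(U N).
apply: (@pa_supermartingale _ _ U (m * K)) => [|s vs|t s Kt vs].
- exact: leq_trans KT TN.
- rewrite /U (minn_idPl KT) -prodr_const; apply: ler_prod => i _.
  have := bdeg_subr1_ge1 s i (leqnn _); move: (_ - 1) => x x1.
  rewrite divr_ge0 ?sqrtr_ge0 //=; last by lra.
  by rewrite ler_pdivrMr ?ler_peMr ?sqrtr_ge0 //; lra.
rewrite /U; have [tT|] := boolP (t < T)%N.
  by rewrite (minn_idPl tT) (minn_idPl (ltnW tT)); exact: neg_moment_step.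
rewrite -leqNgt => tT; rewrite (minn_idPr tT) (minn_idPr (leqW tT)).
by rewrite pa_step_const // => v; apply: eq_bigr => i _; rewrite bdeg_update.
Qed.

(** Markov's inequality: on this event each factor of [neg_moment] exceeds sqrt(m K) / e, while its
    mean is at most sqrt(m K)^#|S|. *)
Lemma prob_all_small S (b : nat) (e : R) : 0 < e -> (0 < K)%N ->
  (K <= b)%N -> (m * b <= N)%N ->
  pa_prob R (fun s : config => forall i, i \in S ->
    (bdeg m s (m * b) i)%:R < e * Num.sqrt (b%:R / K%:R)) <= e ^+ #|S|.
Proof.
move=> e0 K0 Kb bN; have m0 : (0 < m)%N by exact: ltnW.
have Kt : (m * K <= m * b)%N by rewrite leq_mul2l Kb orbT.
set r : R := Num.sqrt (m * K)%:R.
have r0 : 0 < r by rewrite sqrtr_gt0 ltr0n muln_gt0 m0.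
pose c := (e / r) ^+ #|S|.
have c0 : 0 <= c by rewrite exprn_ge0 // divr_ge0 // ltW.
apply: le_trans
  (pa_prob_markov (F := fun s => c * neg_moment S (m * b) s) _ _) _.
- by move=> s; rewrite mulr_ge0 // neg_moment_ge0.
- move=> s bad; rewrite /c -prodr_const -big_split /=.
  rewrite -[leLHS](expr1n _ #|S|) -prodr_const.
  apply: ler_prod => i iS; rewrite ler01 /=.
  have x1 := bdeg_subr1_ge1 s i Kt; have := bad i iS.
  set x : R := _%:R => xlt.
  rewrite -/x in x1.
  rewrite mulrA ler_pdivlMr; last by lra.
  rewrite mul1r mulrAC /r.
  have -> : e * Num.sqrt (m * b)%:R / Num.sqrt (m * K)%:R =
      e * Num.sqrt (b%:R / K%:R).
    rewrite -mulrA -sqrtrV // -sqrtrM //; congr (_ * Num.sqrt _).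
    rewrite !natrM -mulf_div divff ?mul1r // pnatr_eq0; lia.
  by lra.
under eq_bigr do rewrite mulrCA.
rewrite -mulr_sumr.
apply: le_trans (ler_wpM2l c0 (mean_neg_moment S _)) _; first by rewrite Kt.
by rewrite -/r -exprMn divfK // gt_eqF.
Qed.

End NegativeMoment.

(** * Common neighbours of a fixed pair of blocks *)

Section CommonNeighbour.
Variables (R : realType) (n m K : nat) (a : nat -> R).
Hypotheses (m2 : (2 <= m)%N) (a0 : forall b, 0 <= a b).
Notation config := {ffun 'I_(m * n) -> 'I_(m * n)}.
Implicit Types (s : config) (b i j t : nat).

(** The denominator is that of step m b + 1, the larger of the two for the first two edges of b.
    Since degrees only grow, each of these edges reaches a good block with probability at least
    [a b]. *)
Definition good s b i : bool :=
  a b <= (bdeg m s (m * b) i)%:R / (2 * (m * b) + 3)%:R.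

Definition hit s b i j : bool :=
  (target m s (m * b) == i) && (target m s (m * b).+1 == j).

Lemma good_update s (t v : 'I_(m * n)) b i : (m * b <= t)%N ->
  good (update t s v) b i = good s b i.
Proof. by move=> bt; rewrite /good bdeg_update. Qed.

Lemma hit_update s (t v : 'I_(m * n)) b i j : (m * b + 2 <= t)%N ->
  hit (update t s v) b i j = hit s b i j.
Proof. move=> bt; rewrite /hit !target_update.
have -> : (m * b == t)%N = false by lia.
by have -> : ((m * b).+1 == t)%N = false by lia. Qed.

(* The middle value accounts for a new block b whose first edge has already
   reached block i, while its second edge is still to be drawn. *)
Definition block_weight i j b t s : R :=
  let g := good s b i && good s b j in
  if (t <= m * b)%N then 1 else
  expR (if g then a b ^+ 2 else 0) *
  (if t == (m * b).+1 then
     1 - (if g && (target m s (m * b) == i) then a b else 0)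
   else (~~ hit s b i j)%:R).

Lemma sum_attach_sub s (t : 'I_(m * n)) i (c : R) : (i.+1 * m <= t)%N ->
  pa_valid t s ->
  \sum_v attach_prob R s t v * (1 - c * (v %/ m == i)%N%:R) =
  1 - c * ((bdeg m s t i)%:R / (2 * t + 1)%:R).
Proof.
move=> it vs; rewrite -(sum_attach_block R s _ it) ?(ltnW m2) // mulr_sumr.
rewrite -[X in _ = X - _](attach_prob_sum1 R vs) -sumrB; apply: eq_bigr => v _.
by rewrite mulrBr mulr1 mulrCA.
Qed.

(** When i and j are good, the first edge brings the mean to at most exp(a^2) (1 - a * a) <= 1; the
    second replaces 1 - a by the probability of missing j, which is no larger. Goodness is settled
    at time m b, and later steps change nothing. *)
Lemma block_weight_step i j b s (t : 'I_(m * n)) :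
  (i < K)%N -> (j < K)%N -> (K <= b)%N -> (m * b <= t)%N -> pa_valid t s ->
  pa_step t (block_weight i j b t.+1) s <= block_weight i j b t s.
Proof.
move=> iK jK Kb bt vs.
have it : (i.+1 * m <= t)%N.
  by apply: leq_trans bt; rewrite mulnC leq_mul2l (leq_trans iK Kb) orbT.
have jt : (j.+1 * m <= t)%N.
  by apply: leq_trans bt; rewrite mulnC leq_mul2l (leq_trans jK Kb) orbT.
have [tb|ntb] := eqVneq (t : nat) (m * b)%N.
  rewrite /pa_step /block_weight {3}tb leqnn.
  set g := good s b i && good s b j.
  pose c : R := if g then a b else 0.
  pose w : R := expR (if g then a b ^+ 2 else 0).
  rewrite (eq_bigr (fun v : 'I__ => w * (attach_prob R s t v *
      (1 - c * (v %/ m == i)%N%:R)))); last first.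
    move=> v _; rewrite -tb ltnn eqxx target_update eqxx.
    rewrite !good_update -?tb // -/g mulrCA; congr (_ * (_ * (1 - _))).
    by rewrite /c; case: (g); case: eqP; rewrite ?mulr0 ?mulr1 ?mul0r.
  rewrite -mulr_sumr sum_attach_sub // /w /c.
  case: (boolP g) => [/andP[gi _]|_]; last by rewrite expR0 mul0r subr0 mulr1.
  have ap : a b <= (bdeg m s t i)%:R / (2 * t + 1)%:R.
    apply: le_trans gi _; rewrite tb ler_wpM2l //.
    by rewrite lef_pV2 ?posrE ?ltr0n ?ler_nat; lia.
  rewrite -[leRHS](@expRxMexpNx_1 _ (a b ^+ 2)) ler_wpM2l ?expR_ge0 //.
  apply: le_trans (expR_ge1Dx _); rewrite lerD2l lerN2 expr2.
  by rewrite ler_wpM2l.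
have [tb1|ntb1] := eqVneq (t : nat) (m * b).+1.
  rewrite /pa_step /block_weight {3}tb1 ltnn {3}tb1 eqxx.
  set g := good s b i && good s b j.
  pose c : R := (target m s (m * b) == i)%:R.
  pose w : R := expR (if g then a b ^+ 2 else 0).
  rewrite (eq_bigr (fun v : 'I__ => w * (attach_prob R s t v *
      (1 - c * (v %/ m == j)%N%:R)))); last first.
    move=> v _; rewrite ltnNge -ltnS.
    rewrite tb1 ltnW //= eqSS eqn_leq ltnn /=.
    rewrite !good_update -?tb1 // -/g mulrCA; congr (_ * (_ * _)).
    rewrite /hit !target_update -tb1 eqxx tb1.
    have -> : (m * b == (m * b).+1)%N = false by lia.
    rewrite /c.
    by case: eqP; case: eqP; rewrite ?mulr0 ?mulr1 ?mul0r ?subrr ?subr0.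
  rewrite -mulr_sumr sum_attach_sub // ler_wpM2l ?expR_ge0 // lerD2l lerN2 /c.
  case: (boolP g) => [/andP[_ gj]|_] /=; last by rewrite mulr_ge0 ?divr_ge0.
  case: eqP => _; rewrite ?mul0r ?mul1r //.
  apply: le_trans gj _; have -> : (2 * (m * b) + 3 = 2 * t + 1)%N by lia.
  by rewrite ler_wpM2r ?invr_ge0 // ler_nat leq_bdeg.
(* From here both edges are drawn and the weight is constant in time. *)
have e1 : (t <= m * b)%N = false by lia.
have e2 : (t < m * b)%N = false by lia.
have e3 : ((t : nat) == (m * b).+1) = false by lia.
have e4 : (t.+1 == (m * b).+1) = false by lia.
have -> : block_weight i j b t s = block_weight i j b t.+1 s.
  by rewrite /block_weight e1 e2 e3 e4.
rewrite pa_step_const // => v; rewrite /block_weight e2 e4.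
by rewrite !good_update // hit_update //; lia.
Qed.

Lemma block_weight_final i j b t s : (m * b + 2 <= t)%N ->
  block_weight i j b t s =
  expR (if good s b i && good s b j then a b ^+ 2 else 0) *
  (~~ hit s b i j)%:R.
Proof.
move=> bt; rewrite /block_weight.
have -> : (t <= m * b)%N = false by lia.
by have -> : (t == (m * b).+1) = false by lia.
Qed.

Lemma block_weight_init i j b t s : (t <= m * b)%N ->
  block_weight i j b t s = 1.
Proof. by rewrite /block_weight => ->. Qed.

(** Step t changes only the weight of the block B containing t; earlier blocks have their final
    weight, later ones weight 1, and these factor out as c. *)
Lemma mean_block_weight i j : (i < K)%N -> (j < K)%N -> (K <= n)%N ->
  \sum_(s : config) pa_mass R s *
    \prod_(b < n | (K <= b)%N) block_weight i j b (m * n) s <= 1.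
Proof.
move=> iK jK Kn.
pose V t s := \prod_(b < n | (K <= b)%N) block_weight i j b t s.
apply: (@pa_supermartingale _ _ V (m * K)) => [|s _|t s Kt vs].
- by rewrite leq_mul2l Kn orbT.
- rewrite /V big1 // => b Kb; rewrite block_weight_init //.
  by rewrite leq_mul2l Kb orbT.
have m0 : (0 < m)%N by exact: ltnW.
have ltn : (t %/ m < n)%N by rewrite ltn_divLR // [(n * m)%N]mulnC.
pose B := Ordinal ltn.
have KB : (K <= B)%N by rewrite /= leq_divRL // [(K * m)%N]mulnC.
have Bt : (m * B <= t)%N by rewrite /= [(m * _)%N]mulnC leq_trunc_div.
have other (b : 'I_n) : b != B -> (t < m * b)%N \/ (m * b + 2 <= t)%N.
  rewrite -val_eqE /= neq_ltn => /orP[bB|Bb]; [right|left].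
    have : (b.+1 * m <= t)%N by rewrite -leq_divRL.
    by nia.
  by rewrite [(m * b)%N]mulnC -ltn_divLR.
pose c := \prod_(b < n | (K <= b)%N && (b != B)) block_weight i j b t s.
have cE u : \prod_(b < n | (K <= b)%N && (b != B))
    block_weight i j b t.+1 (update t s u) = c.
  apply: eq_bigr => b /andP[_ /other[tb|bt]].
    by rewrite !block_weight_init // ltnW.
  have bt' : (m * b <= t)%N by lia.
  by rewrite !block_weight_final ?good_update ?hit_update //; lia.
have c0 : 0 <= c.
  apply: prodr_ge0 => b /andP[_ /other[tb|bt]].
    by rewrite block_weight_init // ltnW.
  by rewrite block_weight_final // mulr_ge0 ?expR_ge0.
rewrite /V /pa_step [leRHS](bigD1 B) //=.
rewrite [leLHS](eq_bigr (fun u => c * (attach_prob R s t u *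
    block_weight i j B t.+1 (update t s u)))); last first.
  by move=> u _; rewrite (bigD1 B) // cE [RHS]mulrC mulrA.
rewrite -mulr_sumr mulrC ler_wpM2r //.
exact: block_weight_step.
Qed.

(** Without a hit the product of final weights is the exponential of the sum of a^2 over blocks
    where i and j are both good, hence at least exp(c). Its mean is at most 1, so Markov's
    inequality applies. *)
Lemma prob_no_hit i j (c : R) : (i < K)%N -> (j < K)%N -> (K <= n)%N ->
  pa_prob R (fun s : config =>
    (forall b : 'I_n, (K <= b)%N -> ~~ hit s b i j) /\
    c <= \sum_(b < n | (K <= b)%N && (good s b i && good s b j)) a b ^+ 2) <=
  expR (- c).
Proof.
move=> iK jK Kn.
pose V s := \prod_(b < n | (K <= b)%N) block_weight i j b (m * n) s.
have fin (b : 'I_n) : (m * b + 2 <= m * n)%N by have := ltn_ord b; nia.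
apply: le_trans (pa_prob_markov (F := fun s => expR (- c) * V s) _ _) _.
- move=> s; rewrite mulr_ge0 ?expR_ge0 //; apply: prodr_ge0 => b _.
  by rewrite block_weight_final // mulr_ge0 ?expR_ge0.
- move=> s [nohit cle]; rewrite expRN ler_pdivlMl ?expR_gt0 // mulr1 /V.
  rewrite (eq_bigr (fun b : 'I_n =>
    expR (if good s b i && good s b j then a b ^+ 2 else 0))).
    by rewrite -expR_sum -big_mkcondr ler_expR.
  by move=> b Kb; rewrite block_weight_final // nohit // mulr1.
under eq_bigr do rewrite mulrCA.
rewrite -mulr_sumr -[leRHS]mulr1 ler_wpM2l ?expR_ge0 //.
exact: mean_block_weight.
Qed.

End CommonNeighbour.

(** * Selecting blocks that are usually good, and reading off the clique *)

Lemma card_ge_subset (T : finType) (A : {set T}) (k : nat) : (k <= #|A|)%N ->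
  exists2 B : {set T}, B \subset A & #|B| = k.
Proof.
move=> kA; exists [set x in take k (enum A)].
  by apply/fintype.subsetP => x; rewrite inE => /mem_take; rewrite mem_enum.
by rewrite cardsE (card_uniqP _) ?take_uniq ?enum_uniq // size_takel -?cardE.
Qed.

(** Double counting. Times with fewer than k bad indices contribute at most k H, the others at most
    8k H / 16, together 6k (H / 4). So at most 6k of the 8k indices are bad for weight H / 4 or
    more. *)
Lemma many_light (R : realFieldType) (T : finType) (P : pred T) (w : T -> R)
    (k : nat) (bad : T -> pred 'I_(8 * k)) (H := \sum_(b | P b) w b) :
  (forall b, 0 <= w b) -> 0 < H ->
  \sum_(b | P b && (k <= #|[set i | bad b i]|)%N) w b <= H / 16 ->
  (k <= #|[set i | (\sum_(b | P b && bad b i) w b < H / 4)%R]|)%N.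
Proof.
move=> w0 H0 few; set G := [set i | _].
have lo : #|~: G|%:R * (H / 4) <=
    \sum_(i < 8 * k) \sum_(b | P b && bad b i) w b.
  rewrite mulr_natl -sumr_const.
  rewrite [leRHS](bigID [in ~: G]) /= -[leLHS]addr0 lerD //.
    by apply: ler_sum => i; rewrite !inE -leNgt.
  by apply: sumr_ge0 => i _; apply: sumr_ge0.
have hi : \sum_(i < 8 * k) \sum_(b | P b && bad b i) w b <=
    k%:R * H + (8 * k)%:R * (H / 16).
  apply: le_trans (_ : _ <= k%:R * H + (8 * k)%:R *
    \sum_(b | P b && (k <= #|[set i | bad b i]|)%N) w b) _; last first.
    by rewrite lerD2l ler_wpM2l.
  rewrite (exchange_big_dep P) /=; last by move=> i b _ /andP[].
  rewrite /H !mulr_sumr big_mkcondr /= -big_split /=; apply: ler_sum => b Pb.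
  rewrite (eq_bigl [in [set i | bad b i]]) => [|i]; last by rewrite Pb inE.
  rewrite sumr_const -[_ *+ #|_|]mulr_natl.
  case: leqP => kb; last first.
    by rewrite addr0 ler_wpM2r // ler_nat ltnW.
  rewrite -mulrDl ler_wpM2r // -natrD ler_nat.
  by apply: leq_trans (max_card _) _; rewrite card_ord leq_addl.
have := le_trans lo hi.
have -> : k%:R * H + (8 * k)%:R * (H / 16) = (6 * k)%:R * (H / 4).
  by rewrite !natrM; field.
rewrite ler_pM2r ?divr_gt0 // ler_nat => nG.
by have := cardsC G; rewrite card_ord; lia.
Qed.

Lemma both_heavy (R : realFieldType) (T : finType) (P : pred T) (w : T -> R)
    (p q : pred T) (c : R) : (forall b, 0 <= w b) ->
  \sum_(b | P b && ~~ p b) w b < c -> \sum_(b | P b && ~~ q b) w b < c ->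
  \sum_(b | P b) w b - c *+ 2 <= \sum_(b | P b && (p b && q b)) w b.
Proof.
move=> w0 pc qc.
suff : \sum_(b | P b) w b <= \sum_(b | P b && (p b && q b)) w b +
    \sum_(b | P b && ~~ p b) w b + \sum_(b | P b && ~~ q b) w b.
  by rewrite mulr2n; lra.
rewrite !big_mkcondr /= -!big_split /=; apply: ler_sum => b _.
by have := w0 b; case: (p b); case: (q b) => /=; lra.
Qed.

(** Middle blocks have index at least K and branch blocks below K. The first two edges of a middle
    block determine its ordered pair, so different pairs have different middle blocks. *)
Lemma hit_clique (n m k K : nat) (s : {ffun 'I_(m * n) -> 'I_(m * n)})
    (g : 'I_k -> 'I_n) : (2 <= m)%N -> injective g ->
  (forall i, (g i < K)%N) ->
  (forall i j, exists b : 'I_n, (K <= b)%N && hit s b (g i) (g j)) ->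
  contains_subdivided_clique (PA s) k.
Proof.
move=> m2 g_inj gK hitg; have m0 : (0 < m)%N by exact: ltnW.
pose w i j : 'I_n := xchoose (hitg i j).
have wP i j : (K <= w i j)%N /\ hit s (w i j) (g i) (g j).
  exact: (andP (xchooseP (hitg i j))).
have edge (x : 'I_(m * n)) (u v : 'I_n) : (x %/ m = u)%N ->
    target m s x = v -> (u, v) \in PA s.
  move=> xu sv; apply/mapP; exists (x, s x) => /=.
    by apply: map_f; rewrite mem_filter ltn_ord mem_enum.
  by congr pair; apply: val_inj; rewrite /= ?xu // -sv target_ord.
exists g, w; split => //.
- move=> i j l _ wl; have [+ _] := wP i j.
  by rewrite wl leqNgt gK.
- move=> i j i' j' _ _ ww.
  have [_ /andP[/eqP wi /eqP wj]] := wP i j.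
  have [_ /andP[/eqP wi' /eqP wj']] := wP i' j'.
  by split; apply: g_inj; apply: val_inj => /=; rewrite -?wi -?wj ww.
- move=> i j _; have [_ /andP[/eqP wi /eqP wj]] := wP i j.
  have lt0 : (m * w i j < m * n)%N by rewrite ltn_pmul2l.
  have lt1 : ((m * w i j).+1 < m * n)%N by have := ltn_ord (w i j); nia.
  split; apply/orP; [right|left].
    by apply: (edge (Ordinal lt0)) => //=; rewrite mulKn.
  apply: (edge (Ordinal lt1)) => //=.
  by rewrite -addn1 mulnC divnMDl // divn_small // addn0.
Qed.

(** * The failure probability for a clique of size k *)

Section Clique.
Variables (R : realType) (n m k : nat) (e : R).
Hypotheses (m2 : (2 <= m)%N) (k0 : (0 < k)%N) (e0 : 0 < e).
Hypothesis kn : (8 * k < n)%N.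
Notation config := {ffun 'I_(m * n) -> 'I_(m * n)}.
Implicit Types (s : config).

Definition rate (b : nat) : R :=
  e * Num.sqrt (b%:R / (8 * k)%:R) / (2 * (m * b) + 3)%:R.

Definition total_rate : R := \sum_(b < n | (8 * k <= b)%N) rate b ^+ 2.

Lemma rate_ge0 b : 0 <= rate b.
Proof. by rewrite divr_ge0 // mulr_ge0 ?sqrtr_ge0 // ltW. Qed.

Lemma total_rate_gt0 : 0 < total_rate.
Proof.
have b0 : (0 < 8 * k)%N by rewrite muln_gt0.
rewrite /total_rate (bigD1 (Ordinal kn)) //= ltr_pwDl //.
  rewrite exprn_gt0 // divr_gt0 ?ltr0n ?addn_gt0 ?orbT // mulr_gt0 //.
  by rewrite sqrtr_gt0 divr_gt0 // ltr0n.
by apply: sumr_ge0 => b _; rewrite sqr_ge0.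
Qed.

Definition bad_blocks s (b : nat) : {set 'I_(8 * k)} :=
  [set i : 'I_(8 * k) | ~~ good rate s b i].

(** Some k-subset of the blocks is entirely bad; there are at most 2^(8k) such subsets, and each has
    probability at most e^k. *)
Lemma prob_many_bad (b : 'I_n) : (8 * k <= b)%N ->
  pa_prob R (fun s : config => (k <= #|bad_blocks s b|)%N) <=
  2 ^+ (8 * k) * e ^+ k.
Proof.
move=> kb.
have bN : (m * b <= m * n)%N by rewrite leq_mul2l ltnW ?orbT.
apply: le_trans (le_pa_prob R (B := fun s => exists2 S : {set 'I_(8 * k)},
  #|S| == k & forall i, i \in S -> (bdeg m s (m * b) i)%:R <
    e * Num.sqrt (b%:R / (8 * k)%:R)) _) _.
  move=> s /card_ge_subset[S /fintype.subsetP Sbad cS].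
  exists S; first exact/eqP.
  by move=> i /Sbad; rewrite inE /good -ltNge /rate ltr_pM2r //.
apply: le_trans (pa_prob_union _ _ _) _.
apply: le_trans (_ : _ <= \sum_(S : {set 'I_(8 * k)}) e ^+ k) _; last first.
  rewrite sumr_const -cardsT -powersetT card_powerset cardsT card_ord.
  by rewrite -[leLHS]mulr_natl natrX.
rewrite big_mkcond /=; apply: ler_sum => S _.
case: eqP => [cS|_]; last by rewrite exprn_ge0 // ltW.
by rewrite -[X in _ ^+ X]cS; apply: prob_all_small => //; rewrite muln_gt0.
Qed.

Lemma prob_often_bad :
  pa_prob R (fun s : config => total_rate / 16 <
    \sum_(b < n | (8 * k <= b)%N && (k <= #|bad_blocks s b|)%N) rate b ^+ 2) <=
  16 * (2 ^+ (8 * k) * e ^+ k).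
Proof.
have H0 := total_rate_gt0.
apply: le_trans (pa_prob_markov (F := fun s => 16 / total_rate *
  \sum_(b < n | (8 * k <= b)%N)
     rate b ^+ 2 * (k <= #|bad_blocks s b|)%N%:R) _ _) _.
- move=> s; apply: mulr_ge0; first by rewrite divr_ge0 // ltW.
  by apply: sumr_ge0 => b _; rewrite mulr_ge0 ?sqr_ge0.
- move=> s; rewrite big_mkcondr /=.
  under eq_bigr do rewrite -mulrb -mulr_natr.
  set x := \sum_(b < n | _) _ => lt_x.
  by rewrite mulrAC ler_pdivlMr //; lra.
under eq_bigr do rewrite mulrCA mulr_sumr.
rewrite -mulr_sumr exchange_big /= -mulrA ler_wpM2l //.
rewrite ler_pdivrMl // /total_rate mulr_suml; apply: ler_sum => b kb.
under eq_bigr do rewrite mulrCA.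
rewrite -mulr_sumr ler_wpM2l ?sqr_ge0 //.
apply: le_trans (prob_many_bad kb); rewrite /pa_prob [leRHS]big_mkcond.
apply: ler_sum => s _.
by case: asboolP => [->|/negP/negbTE ->]; rewrite ?mulr1 ?mulr0.
Qed.

(** Outside the event of [prob_often_bad], [many_light] yields k blocks, each bad for less than a
    quarter of the total rate. Any two are then jointly good for at least half of it, and
    [prob_no_hit] is summed over the (8k)^2 ordered pairs. *)
Lemma prob_no_clique :
  pa_prob R (fun s : config => ~ contains_subdivided_clique (PA s) k) <=
  16 * (2 ^+ (8 * k) * e ^+ k) + (8 * k)%:R ^+ 2 * expR (- (total_rate / 2)).
Proof.
pose A (p : 'I_(8 * k) * 'I_(8 * k)) s :=
  (forall b : 'I_n, (8 * k <= b)%N -> ~~ hit s b p.1 p.2) /\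
  total_rate / 2 <= \sum_(b < n | (8 * k <= b)%N &&
    (good rate s b p.1 && good rate s b p.2)) rate b ^+ 2.
apply: le_trans (le_pa_prob R (B := fun s => total_rate / 16 <
    \sum_(b < n | (8 * k <= b)%N && (k <= #|bad_blocks s b|)%N) rate b ^+ 2 \/
  exists2 p, xpredT p & A p s) _) _.
  move=> s; apply: contra_notP => /not_orP[/negP]; rewrite -leNgt => few noA.
  have w0 (b : 'I_n) : 0 <= rate b ^+ 2 by rewrite sqr_ge0.
  have := many_light w0 total_rate_gt0 few.
  set G := [set i | _] => kG.
  pose g (i : 'I_k) : 'I_(8 * k) := enum_val (widen_ord kG i).
  apply: (@hit_clique _ _ _ (8 * k) s (fun i => widen_ord (ltnW kn) (g i)) m2).
  - move=> i j /(congr1 val) /= /val_inj.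
    by move=> /enum_val_inj /(congr1 val) /= /val_inj.
  - by move=> i /=.
  move=> i j; have : g i \in G by exact: enum_valP.
  have : g j \in G by exact: enum_valP.
  rewrite !inE => jG iG; apply: contra_notP noA => nohit.
  exists (g i, g j) => //; split => /= [b kb|].
    by apply/negP => h; apply: nohit; exists b; rewrite kb.
  apply: le_trans (both_heavy w0 iG jG).
  by rewrite -/total_rate [_ / 4 *+ _]mulr2n; lra.
apply: le_trans (pa_prob_or _ _ _) _; apply: lerD; first exact: prob_often_bad.
apply: le_trans (pa_prob_union _ _ _) _.
have -> : (8 * k)%:R ^+ 2 * expR (- (total_rate / 2)) =
    \sum_(p : 'I_(8 * k) * 'I_(8 * k)) expR (- (total_rate / 2)) :> R.
  by rewrite sumr_const card_prod !card_ord -[RHS]mulr_natl !natrM expr2.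
apply: ler_sum => -[i j] _.
by apply: (prob_no_hit m2 rate_ge0 _ (ltn_ord i) (ltn_ord j)); exact: ltnW.
Qed.

End Clique.

(** * Positive probability of a clique, for the finitely many small n *)

Section Positivity.
Variables (R : realType).

(** Every earlier vertex has degree at least 1 through its own edge, so no factor vanishes. *)
Lemma pa_mass_gt0 (N : nat) (s : {ffun 'I_N -> 'I_N}) :
  (forall t : 'I_N, (s t <= t)%N) -> 0 < pa_mass R s.
Proof.
move=> sle; apply: prodr_gt0 => t _; rewrite /attach_prob.
have [st|ts] := ltnP (s t) t; last first.
  have -> : s t = t by apply: val_inj; apply/eqP; rewrite eqn_leq sle.
  by rewrite eqxx divr_gt0 // ltr0n addn1.
rewrite divr_gt0 // ltr0n ?addn1 // /degree (big_rem (s t, s (s t))) /=.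
  by rewrite eqxx.
by apply: map_f; rewrite mem_filter st mem_enum.
Qed.

Variables (m n k : nat).
Hypotheses (m2 : (2 <= m)%N) (kn : (k + k * k <= n)%N).

(* Block k + i * k + j is attached to blocks i and j, so that every ordered
   pair (i, j) of the first k blocks has its own common neighbour. *)
Definition clique_target (t : nat) : nat :=
  let b := (t %/ m - k)%N in
  if [&& k <= t %/ m, b < k * k & t %% m < 2]%N
  then (m * (if t %% m == 0 then b %/ k else b %% k))%N else t.

Lemma clique_target_le t : (clique_target t <= t)%N.
Proof.
rewrite /clique_target; case: ifP => // /and3P[kt bk _].
have k0 : (0 < k)%N by move: bk; case: (k).
apply: (@leq_trans (m * (t %/ m))%N); last by rewrite mulnC leq_trunc_div.
rewrite leq_mul2l; apply/orP; right; apply: leq_trans kt.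
by case: ifP => _; apply: ltnW; rewrite ?ltn_divLR // ltn_pmod.
Qed.

Definition clique_config : {ffun 'I_(m * n) -> 'I_(m * n)} :=
  [ffun t : 'I_(m * n) =>
    Ordinal (leq_ltn_trans (clique_target_le t) (ltn_ord t))].

Lemma clique_config_target (b r : nat) : (b < n)%N -> (r < m)%N ->
  target m clique_config (m * b + r) = (clique_target (m * b + r) %/ m)%N.
Proof.
move=> bn rm; have lt : (m * b + r < m * n)%N by nia.
by rewrite -[(m * b + r)%N]/(val (Ordinal lt)) target_ord ffunE.
Qed.

Lemma clique_config_clique : contains_subdivided_clique (PA clique_config) k.
Proof.
have m0 : (0 < m)%N by exact: ltnW.
have kltn : (k <= n)%N by apply: leq_trans kn; exact: leq_addr.
apply: (@hit_clique _ _ _ k _ (fun i => widen_ord kltn i) m2) => [i j|i|i j].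
- by move=> /(congr1 val) /= /val_inj.
- by rewrite /= ltn_ord.
have ik := ltn_ord i; have jk := ltn_ord j.
have k0 : (0 < k)%N by exact: leq_ltn_trans ik.
have bk : (i * k + j < k * k)%N by nia.
have bn : (k + (i * k + j) < n)%N by apply: leq_trans kn; rewrite ltn_add2l.
exists (Ordinal bn); rewrite /= leq_addr /hit /=.
have tgt r : (r < 2)%N -> target m clique_config (m * (k + (i * k + j)) + r) =
    if r == 0%N then i else j.
  move=> r2; have rm : (r < m)%N by exact: leq_trans m2.
  rewrite clique_config_target // /clique_target.
  have -> b : ((m * b + r) %/ m = b)%N.
    by rewrite mulnC divnMDl // divn_small // addn0.
  have -> b : ((m * b + r) %% m = r)%N by rewrite mulnC modnMDl modn_small.
  rewrite leq_addr addKn bk r2 /= mulKn //.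
  case: ifP => _; first by rewrite divnMDl // divn_small // addn0.
  by rewrite modnMDl modn_small.
by rewrite -[X in target _ _ X]addn0 tgt // -addn1 tgt // !eqxx.
Qed.

Lemma prob_clique_gt0 :
  0 < pa_prob R (fun s : {ffun 'I_(m * n) -> 'I_(m * n)} =>
    contains_subdivided_clique (PA s) k).
Proof.
rewrite /pa_prob (bigD1 clique_config) /=.
  rewrite ltr_pwDl ?sumr_ge0 // => [|s _]; last exact: pa_mass_ge0.
  by apply: pa_mass_gt0 => t; rewrite ffunE clique_target_le.
by apply/asboolP; exact: clique_config_clique.
Qed.

End Positivity.

(** * Numerical estimates for the rates and the failure bound *)

Section Asymptotics.
Variable R : realType.

(** Induction on n with ln (1 + 1 / n) <= 1 / n. *)
Lemma ln_le_harmonic (K n : nat) : (0 < K)%N -> (K <= n)%N ->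
  ln n%:R - ln K%:R <= \sum_(K <= b < n) b%:R^-1 :> R.
Proof.
move=> K0; elim: n => [|n IH].
  by rewrite leqn0 => /eqP ->; rewrite subrr big_geq.
rewrite leq_eqVlt => /predU1P[->|Kn]; first by rewrite subrr big_geq.
rewrite big_nat_recr //=; apply: le_trans (lerD (IH Kn) (lexx _)).
have n0 : (0 < n%:R :> R) by rewrite ltr0n (leq_trans K0).
have -> : n.+1%:R = n%:R * (1 + n%:R^-1) :> R.
  by rewrite mulrDr mulr1 divff ?gt_eqF // natr1.
have ni : 0 < n%:R^-1 :> R by rewrite invr_gt0.
rewrite lnM ?posrE //.
have n1 : -1 < n%:R^-1 :> R by lra.
by have := le_ln1Dx n1; lra.
Qed.

Lemma ln_le_subr1 (n : nat) : (0 < n)%N -> ln n%:R <= n%:R - 1 :> R.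
Proof.
move=> n0; have n0' : 0 < n%:R :> R by rewrite ltr0n.
have := @le_ln1Dx R (n%:R - 1); rewrite [1 + _]addrC subrK; apply; lra.
Qed.

(** From 2 m b + 3 <= 5 m b; the constant is 200 = 8 * 5^2. *)
Lemma rate_sqr_ge (n m k : nat) (e : R) (b : nat) :
  (0 < m)%N -> (0 < k)%N -> (0 < b)%N ->
  e ^+ 2 / (200 * m%:R ^+ 2 * k%:R) * b%:R^-1 <= rate m k e b ^+ 2.
Proof.
move=> m0 k0 b0; rewrite /rate expr_div_n exprMn sqr_sqrtr ?divr_ge0 //.
move: (e ^+ 2) (sqr_ge0 e) => f f0; rewrite -!mulrA ler_wpM2l //.
have mR : 0 < m%:R :> R by rewrite ltr0n.
have kR : 0 < k%:R :> R by rewrite ltr0n.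
have bR : 0 < b%:R :> R by rewrite ltr0n.
have d0 : (2 * (m * b) + 3)%:R ^+ 2 <= (5 * (m%:R * b%:R)) ^+ 2 :> R.
  rewrite -!natrM lerXn2r ?nnegrE // ler_nat.
  have : (0 < m * b)%N by rewrite muln_gt0 m0.
  by lia.
have d1 : 0 < (2 * (m * b) + 3)%:R ^+ 2 :> R.
  by rewrite exprn_gt0 // ltr0n addn_gt0 orbT.
apply: (@le_trans _ _ (b%:R * ((8 * k)%:R^-1 / (5 * (m%:R * b%:R)) ^+ 2))).
  rewrite natrM le_eqVlt; apply/orP; left; apply/eqP.
  by field; rewrite !gt_eqF.
rewrite ler_wpM2l // ler_wpM2l ?invr_ge0 // lef_pV2 ?posrE //.
exact: lt_le_trans d1 d0.
Qed.

Lemma total_rate_ge (n m k : nat) (e : R) :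
  (0 < m)%N -> (3 <= k)%N -> (8 * k <= n)%N -> k%:R ^+ 4 <= ln n%:R :> R ->
  e ^+ 2 / (400 * m%:R ^+ 2) * k%:R ^+ 3 <= total_rate n m k e.
Proof.
move=> m0 k3 kn kln; have k0 : (0 < k)%N by lia.
have K0 : (0 < 8 * k)%N by rewrite muln_gt0.
have mR : 0 < m%:R :> R by rewrite ltr0n.
have kR : 0 < k%:R :> R by rewrite ltr0n.
apply: (@le_trans _ _ (e ^+ 2 / (200 * m%:R ^+ 2 * k%:R) *
    \sum_((8 * k)%N <= b < n) b%:R^-1)).
  apply: (@le_trans _ _ (e ^+ 2 / (200 * m%:R ^+ 2 * k%:R) * (k%:R ^+ 4 / 2))).
    rewrite le_eqVlt; apply/orP; left; apply/eqP.
    by field; rewrite !gt_eqF.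
  apply: ler_wpM2l.
    by apply: divr_ge0; rewrite ?sqr_ge0 // !mulr_ge0 ?exprn_ge0.
  apply: le_trans (ln_le_harmonic K0 kn).
  (* For k >= 3, ln (8k) <= 8k and k^4 >= 27k, so ln (8k) takes away at most half of k^4. *)
  have := ln_le_subr1 K0; rewrite natrM.
  have : 3 <= k%:R :> R by rewrite ler_nat.
  move=> z3; have : 27 * k%:R <= k%:R ^+ 4 :> R.
    rewrite exprSr ler_wpM2r //; have -> : 27 = 3 ^+ 3 :> R by ring.
    by rewrite lerXn2r ?nnegrE.
  by lra.
rewrite big_geq_mkord mulr_sumr; apply: ler_sum => b kb.
by apply: rate_sqr_ge => //; exact: leq_trans kb.
Qed.

Lemma expRN4_le : expR (- 4) <= 16^-1 :> R.
Proof.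
rewrite expRN lef_pV2 ?posrE ?expR_gt0 //.
have -> : 4 = 4%:R * 1 :> R by rewrite mulr1.
rewrite expRM_natl; have -> : 16 = 2 ^+ 4 :> R by ring.
rewrite lerXn2r ?nnegrE ?expR_ge0 //.
by apply: le_trans (expR_ge1Dx _); lra.
Qed.

(** The choice e = 2^-10 turns 2^(8k) e^k into 4^-k. As H / 2 >= 4k, the second term is at most 64 *
    4^k * 16^-k. The sum is at most 80 * 4^-k, and 80 <= 2^7 <= 2^k. *)
Lemma failure_bound (k : nat) (g H : R) : (7 <= k)%N -> 8 <= g * k%:R ^+ 2 ->
  g * k%:R ^+ 3 <= H ->
  16 * (2 ^+ (8 * k) * (1 / 2 ^+ 10) ^+ k) +
    (8 * k)%:R ^+ 2 * expR (- (H / 2)) <= 2^-1 ^+ k.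
Proof.
move=> k7 gk gH.
have q0 : 0 <= 4^-1 ^+ k :> R by rewrite exprn_ge0.
have -> : 2 ^+ (8 * k) * (1 / 2 ^+ 10) ^+ k = 4^-1 ^+ k :> R.
  by rewrite exprM -exprMn; congr (_ ^+ _); field.
have eH : expR (- (H / 2)) <= 4^-1 ^+ k * 4^-1 ^+ k.
  rewrite -exprMn; have -> : 4^-1 * 4^-1 = 16^-1 :> R by field.
  apply: le_trans (_ : _ <= expR (- 4) ^+ k) _; last first.
    by rewrite lerXn2r ?nnegrE ?expR_ge0 // expRN4_le.
  rewrite -expRM_natl ler_expR.
  have := ler_wpM2r (ler0n R k) gk; rewrite -mulrA -exprSr; lra.
have kk : (8 * k)%:R ^+ 2 <= 64 * 4 ^+ k :> R.
  rewrite -natrX -[4]/(4%:R) -natrX -[64]/(64%:R) -natrM ler_nat expnMn.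
  rewrite leq_mul2l /= -[4%N]/(2 ^ 2)%N -expnM mulnC expnM leq_exp2r //.
  by rewrite ltnW // ltn_expl.
have kH : (8 * k)%:R ^+ 2 * expR (- (H / 2)) <= 64 * 4^-1 ^+ k.
  apply: le_trans (ler_pM (sqr_ge0 _) (expR_ge0 _) kk eH) _.
  by rewrite mulrA -[64 * _ * _]mulrA -exprMn divff // expr1n mulr1.
have k80 : 80 <= 2 ^+ k :> R.
  apply: le_trans (_ : _ <= 2 ^+ 7) _; first by lra.
  by apply: ler_weXn2l => //; lra.
apply: le_trans (lerD (lexx _) kH) _.
have -> : 2^-1 ^+ k = 2 ^+ k * 4^-1 ^+ k :> R.
  by rewrite -exprMn; congr (_ ^+ _); field.
by have := ler_wpM2r q0 k80; lra.
Qed.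

End Asymptotics.

(** * Choice of the constants, separately for small and large n *)

Theorem theorem3 (R : realType) (m : nat) (hm : (2 <= m)%N) :
  exists c : R, 0 < c /\
    forall n : nat, (0 < n)%N ->
      1 - expR (- (c * ln (n%:R : R) `^ (1 / 4))) <=
      pa_prob R (fun s : {ffun 'I_(m * n) -> 'I_(m * n)} =>
        contains_subdivided_clique (PA s)
          (Num.truncn (ln (n%:R : R) `^ (1 / 4)))).
Proof.
pose x n : R := ln (n%:R : R) `^ (1 / 4).
pose p n : R := pa_prob R (fun s : {ffun 'I_(m * n) -> 'I_(m * n)} =>
        contains_subdivided_clique (PA s) (Num.truncn (x n))).
have x0 n : 0 <= x n by exact: powR_ge0.
have m0 : (0 < m)%N by exact: ltnW.
have x4 n : (0 < n)%N -> x n ^+ 4 = ln n%:R.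
  move=> n0; rewrite -powR_mulrn // -powRrM mul1r mulVf // powRr1 //.
  by rewrite ln_ge0 // ler1n.
have k4 n : (0 < n)%N -> (Num.truncn (x n))%:R ^+ 4 <= ln n%:R :> R.
  by move=> n0; rewrite -x4 // lerXn2r ?nnegrE // truncn_le.
have k4n n : (0 < n)%N -> (Num.truncn (x n) ^ 4 < n)%N.
  move=> n0; rewrite -(ltr_nat R) natrX.
  by have := k4 n n0; have := ln_le_subr1 R n0; lra.
(* There is room for the explicit clique: k + k^2 <= k^4 + 1 <= n. *)
have p_gt0 n : (0 < n)%N -> 0 < p n.
  move=> n0; apply: prob_clique_gt0 => //.
  have := k4n n n0; case: (Num.truncn _) => [|[|k]] //.
  by rewrite !expnS expn0; nia.
have small n0 : exists2 c : R, 0 < c & forall n, (0 < n)%N -> (n < n0)%N ->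
    1 - expR (- (c * x n)) <= p n.
  elim: n0 => [|n0 [c c0 IH]]; first by exists 1.
  have [->|n0_gt0] := posnP n0; first by exists c => // -[|n].
  (* Since 1 - exp(-y) <= y, it suffices that c * x <= p; adding 1 to the denominator covers x =
     0. *)
  have y0 : 0 < p n0 / (1 + x n0) by rewrite divr_gt0 ?p_gt0 ?ltr_wpDr.
  exists (Order.min c (p n0 / (1 + x n0))); first by rewrite lt_min c0 y0.
  move=> n n_gt0; rewrite ltnS leq_eqVlt => /predU1P[->|nn0].
    rewrite lerBlDr -lerBlDl; apply: le_trans (expR_ge1Dx _).
    rewrite lerD2l lerN2.
    apply: le_trans (_ : _ <= p n0 / (1 + x n0) * x n0) _.
      by rewrite ler_wpM2r // ge_min lexx orbT.
    rewrite mulrAC ler_pdivrMr ?ltr_wpDr //.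
    by rewrite ler_wpM2l ?lerDr ?ltW ?p_gt0.
  apply: le_trans (IH n n_gt0 nn0); rewrite lerB // ler_expR lerN2.
  by rewrite ler_wpM2r // ge_min lexx.
pose e : R := 1 / 2 ^+ 10.
have e0 : 0 < e by rewrite divr_gt0 // exprn_gt0.
pose g : R := e ^+ 2 / (400 * m%:R ^+ 2).
have g0 : 0 < g by rewrite divr_gt0 ?mulr_gt0 ?exprn_gt0 // ltr0n.
(* The two summands serve the hypotheses k >= 7 and g k^2 >= 8 of [failure_bound]; n >= [n0] then
   forces ln n >= k0^4, hence k >= k0. *)
pose k0 := (7 + (Num.truncn (8 / g)%R).+1)%N.
pose n0 := (Num.truncn (expR (k0%:R ^+ 4) : R)).+1.
have [c c0 csmall] := small n0.
have l2 : 0 < ln 2 :> R by rewrite ln_gt0 // ltr1n.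
exists (Order.min c (ln 2 / 2)); split; first by rewrite lt_min c0 divr_gt0.
move=> n n_gt0; rewrite -/(x n) -/(p n).
have [nn0|n0n] := ltnP n n0.
  apply: le_trans (csmall n n_gt0 nn0); rewrite lerB // ler_expR lerN2.
  by rewrite ler_wpM2r // ge_min lexx.
set k := Num.truncn (x n).
have k0k : (k0 <= k)%N.
  rewrite /k truncn_ge_nat // -(@ler_pXn2r _ 4) ?nnegrE // x4 //.
  rewrite -ler_expR lnK ?posrE ?ltr0n //.
  apply: ltW; apply: lt_le_trans (truncnS_gt _) _.
  by rewrite ler_nat.
have k7 : (7 <= k)%N by apply: leq_trans k0k; exact: leq_addr.
have kn : (8 * k < n)%N.
  apply: leq_ltn_trans (k4n n n_gt0); rewrite -/k expnSr leq_mul2r.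
  by rewrite -[8%N]/(2 ^ 3)%N leq_exp2r // (leq_trans _ k7) // orbT.
have gk : 8 <= g * k%:R ^+ 2.
  rewrite mulrC -ler_pdivrMr //; apply: le_trans (ltW (truncnS_gt _)) _.
  rewrite -natrX ler_nat; apply: leq_trans (leq_trans _ k0k) _.
    by rewrite /k0 leq_addl.
  by rewrite expnS expn1; nia.
rewrite /p pa_probC lerB //.
have k_gt0 : (0 < k)%N by lia.
apply: le_trans (prob_no_clique hm k_gt0 e0 kn) _.
have k3 : (3 <= k)%N by exact: leq_trans k7.
have gH := total_rate_ge e m0 k3 (ltnW kn) (k4 n n_gt0).
apply: le_trans (failure_bound k7 gk gH) _.
have -> : 2^-1 ^+ k = expR (- ln 2) ^+ k :> R by rewrite expRN lnK ?posrE.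
rewrite -expRM_natl ler_expR mulrN lerN2.
(* The halving of ln 2 pays for truncation: x < k + 1 <= 2k. *)
apply: le_trans (_ : _ <= ln 2 / 2 * x n) _.
  by rewrite ler_wpM2r // ge_min lexx orbT.
have := truncnS_gt (x n); rewrite -/k -natr1.
have : 1 <= k%:R :> R by rewrite ler1n.
move: l2; move: (ln 2) (x n) (k%:R : R) => l y z l2 z1 yz.
by nra.
Qed.
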